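(* Let $R$ be a Bézout domain. All superdecomposable pure-injective $R$-modules are $R_{S_\infty(R)}$-modules (i.e. every element of $S_\infty(R)$ acts bijectively on every superdecomposable pure-injective $R$-module).
   Context: A Bézout domain is an integral domain whose finitely generated ideals are principal. A module is superdecomposable if it is non-zero and has no non-zero indecomposable direct summands. All localisations of $R$ are identified with subsets of its field of fractions. For a Bézout domain $R$, $S(R)$ is the multiplicatively closed set generated by the units and all irreducible elements of $R$. Define, by ordinal induction, $S_0(R)$ to be the set of units of $R$, $S_{\alpha+1}(R):=R\cap S(R_{S_\alpha(R)})$, and $S_\lambda(R):=\bigcup_{\alpha<\lambda}S_\alpha(R)$ for $\lambda$ a limit ordinal. Finally $S_\infty(R):=\bigcup_{\alpha\in\mathrm{Ord}}S_\alpha(R)$. $R_{S_\infty(R)}$ is the localisation of $R$ at $S_\infty(R)$. *)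

(* Defs.v *)
From mathcomp Require Import all_boot all_order all_algebra.
From mathcomp Require Import fraction boolp classical_sets.

Set Implicit Arguments.
Unset Strict Implicit.
Unset Printing Implicit Defensive.

Import Order.TTheory GRing.Theory.

Local Open Scope classical_set_scope.
Local Open Scope ring_scope.

Definition bezout_domain (R : idomainType) : Prop :=
  forall (n : nat) (a : 'I_n -> R), exists d : R,
    [set x | exists c : 'I_n -> R, x = \sum_(i < n) c i * a i] =
    [set x | exists c : R, x = c * d].

Section SubringsOfFractionField.
Variable R : idomainType.
Local Notation K := {fraction R}.
Local Notation "x %:F" := (@FracField.tofrac R x).

(* The localisation of R at S, as a subset of the field of fractions. *)
Definition localisation (S : set R) : set K :=
  [set x | exists (a s : R), S s /\ x = a%:F / s%:F].

(* In the next three definitions, A is the carrier of a subring of K. *)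
Definition unit_in (A : set K) (u : K) : Prop :=
  A u /\ exists v, A v /\ u * v = 1.

Definition irreducible_in (A : set K) (p : K) : Prop :=
  [/\ A p, p <> 0, ~ unit_in A p &
      forall a b, A a -> A b -> p = a * b -> unit_in A a \/ unit_in A b].

Inductive S_of (A : set K) : K -> Prop :=
  | S_of_unit u : unit_in A u -> S_of A u
  | S_of_irreducible p : irreducible_in A p -> S_of A p
  | S_of_mul x y : S_of A x -> S_of A y -> S_of A (x * y).

(* S_alpha |-> S_(alpha + 1) *)
Definition S_next (S : set R) : set R :=
  [set r | S_of (localisation S) r%:F].

End SubringsOfFractionField.

(* An ordinal is represented by a point w of a well-ordered type W: it is the
   order type of the initial segment of the points below w.                  *)
Section OrdinalStages.
Variables (d : Order.disp_t) (W : orderType d).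

Definition is_zero (w : W) : Prop := forall v : W, ~ (v < w)%O.

Definition is_succ (v w : W) : Prop :=
  (v < w)%O /\ forall u : W, ~ ((v < u)%O /\ (u < w)%O).

Definition is_limit (w : W) : Prop :=
  (exists v : W, (v < w)%O) /\ forall v, ~ is_succ v w.

Variable wfW : well_founded (fun v w : W => (v < w)%O).
Variable R : idomainType.

Definition S_step (w : W) (S : forall v : W, (v < w)%O -> set R) : set R :=
  [set r | [\/ is_zero w /\ r \is a GRing.unit,
               exists (v : W) (vw : (v < w)%O),
                 is_succ v w /\ S_next (S v vw) r |
               is_limit w /\ exists (v : W) (vw : (v < w)%O), S v vw r]].

Definition S_stage : W -> set R := Fix wfW (fun=> set R) S_step.

Lemma S_stageE w : S_stage w = S_step (w := w) (fun v _ => S_stage v).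
Proof.
apply: (Fix_eq wfW (fun=> set R)) => x f g fg.
by congr (S_step _); apply/functional_extensionality_dep => v;
  apply/functional_extensionality_dep => vx; exact: fg.
Qed.

Lemma S_stage_zero w :
  is_zero w -> S_stage w = [set r | r \is a GRing.unit].
Proof.
move=> w0; rewrite S_stageE; apply/seteqP; split => r /=; last by constructor 1.
case=> [[]//|[v [vw _]]|[_ [v [vw _]]]]; by have := w0 _ vw.
Qed.

Lemma S_stage_succ v w : is_succ v w -> S_stage w = S_next (S_stage v).
Proof.
move=> vw; rewrite S_stageE; apply/seteqP; split => r /=; last first.
  by move=> Sr; constructor 2; exists v, vw.1.
case=> [[w0 _]|[u [_ [uw]]]|[[_ /(_ _ vw)]//]]; first by case: (w0 _ vw.1).
suff -> : u = v by [].
case: (ltgtP u v) => // uv; first by case: (uw.2 v); split => //; exact: vw.1.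
by case: (vw.2 u); split => //; exact: uw.1.
Qed.

Lemma S_stage_limit w :
  is_limit w -> S_stage w = \bigcup_(v in [set v : W | (v < w)%O]) S_stage v.
Proof.
move=> wl; rewrite S_stageE; apply/seteqP; split => r /=; last first.
  by case=> v vw Sr; constructor 3; split=> //; exists v, vw.
case=> [[w0 _]|[u [_ [uw _]]]|[_ [v [vw Sr]]]]; last by exists v.
  by have [[v vw] _] := wl; case: (w0 _ vw).
by case: (wl.2 _ uw).
Qed.

End OrdinalStages.

Definition S_infty (R : idomainType) : set R :=
  [set r : R | exists (d : Order.disp_t) (W : orderType d)
             (wfW : well_founded (fun v w : W => (v < w)%O)) (w : W),
           S_stage wfW w r].

Section Modules.
Variable R : idomainType.

Definition direct_sum (M : lmodType R) (N A B : set M) : Prop :=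
  [/\ submod_closed (mem A), submod_closed (mem B),
      N = [set x | exists a b, [/\ A a, B b & x = a + b]] &
      A `&` B = [set 0]].

Definition direct_summand (M : lmodType R) (A : set M) : Prop :=
  exists B : set M, direct_sum setT A B.

Definition indecomposable (M : lmodType R) (N : set M) : Prop :=
  N <> [set 0] /\
  forall A B : set M, direct_sum N A B -> A = [set 0] \/ B = [set 0].

Definition superdecomposable (M : lmodType R) : Prop :=
  (exists m : M, m <> 0) /\
  ~ exists N : set M, direct_summand N /\ indecomposable N.

(* Finite systems of linear equations with constants in A that are solvable
   in B are solvable in A.                                                   *)
Definition pure_embedding (A B : lmodType R) (f : {linear A -> B}) : Prop :=
  injective f /\
  forall (m n : nat) (C : 'M[R]_(m, n)) (a : 'I_m -> A),
    (exists y : 'I_n -> B, forall i, \sum_(j < n) C i j *: y j = f (a i)) ->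
    exists x : 'I_n -> A, forall i, \sum_(j < n) C i j *: x j = a i.

Definition pure_injective (M : lmodType R) : Prop :=
  forall (A B : lmodType R) (f : {linear A -> B}), pure_embedding f ->
  forall g : {linear A -> M}, exists h : {linear B -> M}, forall a, h (f a) = g a.

(* The R-action on M extends, necessarily uniquely, to the localisation of R
   at S.                                                                     *)
Definition localised_module (S : set R) (M : lmodType R) : Prop :=
  forall s : R, S s -> bijective (fun m : M => s *: m).

End Modules.

(* Main.v *)
Require Import Defs.
From mathcomp Require Import all_boot all_order all_algebra.
From HB Require Import structures.
From mathcomp Require Import fraction generic_quotient ring_quotient.
From mathcomp Require Import boolp classical_sets functions.
From mathcomp Require Import ring.

                                                                             
                                                                               
                                                                            
                                                                          
                                                                         
                            
                                                                               
                 

                                                                          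
                                                                            
                                                                               
                                                                
                                                        

                                                                                
                                                                            
                                                                              
                                                                       
                                                        
                         

                                                
                                                                                
                                                                           
                                                                              
                                                                           
                                               

                                                                        
                                                                          
                                                                              
                                                                          
                                                             
Set Implicit Arguments.
Unset Strict Implicit.
Unset Printing Implicit Defensive.

Import GRing.Theory.

Local Open Scope quotient_scope.
Local Open Scope ring_scope.

                                         
Section Linear.
Variables (R : idomainType) (U V : lmodType R).

Definition linear_pack (f : U -> V) (f_lin : linear f) : {linear U -> V} :=
  HB.pack f (GRing.isLinear.Build R U V _ f f_lin).

Definition submodule (K : set U) : Prop :=
  K 0 /\ forall r x y, K x -> K y -> K (r *: x + y).

End Linear.

Section Quotient.
Variables (R : idomainType) (L : lmodType R) (K : set L).
Hypothesis K_sub : submodule K.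

Let Kp : {pred L} := mem K.

Let Kp_closed : zmod_closed Kp.
Proof.
have [K0 KD] := K_sub.
split=> [|x y]; rewrite !inE // => Kx Ky.
by rewrite addrC -scaleN1r; exact: KD.
Qed.

Let Ki : zmodClosed L :=
  HB.pack Kp (GRing.isZmodClosed.Build L Kp Kp_closed).

Local Notation Q := (Quotient.quot Ki).
Let proj : L -> Q := \pi_Q.

Let proj_eq x y : proj x = proj y <-> K (x - y).
Proof.
split=> [/eqP|Kxy]; last (apply/eqP; move: Kxy).
  by rewrite -Quotient.idealrBE inE.
by rewrite -Quotient.idealrBE inE.
Qed.

Let sc (r : R) (x : Q) : Q := proj (r *: repr x).

Let sc_proj r x : sc r (proj x) = proj (r *: x).
Proof.
apply/proj_eq; rewrite -scalerBr -[_ *: _]addr0; apply: K_sub.2 K_sub.1.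
by apply/proj_eq; rewrite /proj reprK.
Qed.

Let projD x y : proj (x + y) = proj x + proj y.
Proof. by rewrite /proj raddfD. Qed.

Let projP (x : Q) : exists y, x = proj y.
Proof. by exists (repr x); rewrite /proj reprK. Qed.

Let scA a b v : sc a (sc b v) = sc (a * b) v.
Proof. by have [x ->] := projP v; rewrite !sc_proj scalerA. Qed.

Let sc1 : left_id 1 sc.
Proof. by move=> v; have [x ->] := projP v; rewrite !sc_proj scale1r. Qed.

Let scDr : right_distributive sc +%R.
Proof.
move=> r v w; have [x ->] := projP v; have [y ->] := projP w.
by rewrite -projD !sc_proj scalerDr projD.
Qed.

Let scDl v : {morph sc^~ v : a b / a + b}.
Proof.
by move=> a b /=; have [x ->] := projP v; rewrite !sc_proj scalerDl projD.
Qed.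

Let QM : lmodType R :=
  HB.pack Q (GRing.Zmodule_isLmodule.Build R Q scA sc1 scDr scDl).

Lemma quotient_module : exists (Q : lmodType R) (pi : {linear L -> Q}),
  (forall y, exists x, y = pi x) /\ forall x, pi x = 0 <-> K x.
Proof.
have proj_lin : linear (proj : L -> QM).
  by move=> r x y; rewrite projD -sc_proj.
exists QM, (linear_pack proj_lin); split=> [y|x]; first exact: projP.
rewrite -[x in K x]subr0 -proj_eq.
suff -> : proj 0 = 0 by [].
by rewrite /proj raddf0.
Qed.

End Quotient.

                                        
Section PureInjective.
Variables (R : idomainType) (M : lmodType R).
Hypothesis M_pi : pure_injective M.

                                                                             
                                                                        
                                                                                
                         
Lemma pure_injective_kill (L : lmodType R) (K : set (M * L)%type) :
  submodule K ->
  (forall m n (C : 'M[R]_(m, n)) (y : 'I_n -> (M * L)%type) (a : 'I_m -> M),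
     (forall i, K (\sum_(j < n) C i j *: y j - (a i, 0))) ->
     exists x : 'I_n -> M, forall i, \sum_(j < n) C i j *: x j = a i) ->
  exists u : {linear L -> M}, forall z, K z -> z.1 + u z.2 = 0.
Proof.
move=> K_sub K_pure; have [Q [pi [pi_surj pi_ker]]] := quotient_module K_sub.
have inl_lin : linear (fun x : M => (x, 0) : (M * L)%type).
  by move=> r x y; congr pair => /=; rewrite scaler0 addr0.
have inr_lin : linear (fun x : L => (0, x) : (M * L)%type).
  by move=> r x y; congr pair => /=; rewrite scaler0 addr0.
pose f : {linear M -> Q} := pi \o linear_pack inl_lin.
have f_pure : pure_embedding f.
  split.
    suff f0 x : f x = 0 -> x = 0.
      by move=> x y /eqP; rewrite -subr_eq0 -linearB => /eqP/f0/subr0_eq.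
    move=> /pi_ker /= Kx.
    have [|y] := K_pure 1%N 0%N 0 (fun=> 0) (fun=> - x).
      move=> i; rewrite big_ord0 sub0r.
      suff -> : - (- x, 0) = (x, 0) :> M * L by [].
      by congr pair; rewrite /= ?opprK ?oppr0.
    by move/(_ ord0); rewrite big_ord0 => /esym/eqP; rewrite oppr_eq0 => /eqP.
  move=> m n C a [y yP].
  have /choice[z zP] j : exists z, y j = pi z by exact: pi_surj.
  apply: (K_pure m n C z a) => i; apply/pi_ker.
  rewrite linearB linear_sum /= -[pi (a i, 0)]yP; apply/subr0_eq.
  rewrite subr0; apply/eqP; rewrite subr_eq0; apply/eqP.
  by apply: eq_bigr => j _; rewrite linearZ /= zP.
have [h hP] := M_pi f_pure (idfun : {linear M -> M}).
exists (h \o (pi \o linear_pack inr_lin)) => -[x l] /= Kz.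
rewrite -[x in x + _]hP -[LHS]/(h (pi (x, 0)) + h (pi (0, l))) -!linearD.
suff -> : pi ((x, 0) + (0, l)) = 0 by rewrite linear0.
apply/pi_ker; suff -> : (x, 0) + (0, l) = (x, l) :> M * L by [].
by congr pair; rewrite /= ?addr0 ?add0r.
Qed.

Lemma directed_finite (I T : Type) (S : I -> set T) (i0 : I) :
  (forall i j, exists k, S k `<=` S i `&` S j)%classic ->
  forall n (s : 'I_n -> I), exists k, forall j, (S k `<=` S (s j))%classic.
Proof.
move=> S_dir; elim=> [|n IH] s; first by exists i0 => -[].
have [k kP] := IH (fun j => s (lift ord0 j)).
have [k' k'P] := S_dir k (s ord0).
exists k' => j; case: (unliftP ord0 j) => [j'|] -> x /k'P[Sk S0] //.
exact: kP.
Qed.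

                                                                                
                                                                        
                                                                            
                                                                                
                                              
Lemma pure_injective_compact (L : lmodType R) (I : Type) (i0 : I)
    (S : I -> set {linear L -> M}) :
  (forall i j, exists k, S k `<=` S i `&` S j)%classic ->
  (forall i, exists v, S i v) ->
  exists u : {linear L -> M},
    forall i l a, (forall v, S i v -> v l = a) -> u l = a.
Proof.
move=> S_dir S_ex.
pose K : set (M * L)%type :=
  [set z : (M * L)%type | exists i,
     forall v : {linear L -> M}, S i v -> z.1 + v z.2 = 0]%classic.
have K_sub : submodule K.
  split; first by exists i0 => v _ /=; rewrite linear0 addr0.
  move=> r x y [i iP] [j jP]; have [k kP] := S_dir i j.
  exists k => v /kP[/iP vx /jP vy] /=.
  by rewrite linearP addrACA -scalerDr vx vy scaler0 addr0.
have [|u uP] := pure_injective_kill K_sub.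
  move=> m n C y a /= /choice[s sP].
  have [k kP] := directed_finite i0 S_dir s.
  have [v vP] := S_ex k.
  exists (fun j => (y j).1 + v (y j).2) => i.
  have /= := sP i v (kP i v vP).
  rewrite subr0 !raddf_sum /= addrAC => /subr0_eq <-.
  rewrite -big_split /=; apply: eq_bigr => j _.
  by rewrite scalerDr linearZ.
exists u => i l a vP; have /= := uP (- a, l).
rewrite addrC => /(_ _)/subr0_eq; apply; exists i => v /vP /= ->.
by rewrite addNr.
Qed.

End PureInjective.

Section Extension.
Variables (R : idomainType) (M : lmodType R).
Hypothesis M_pi : pure_injective M.

                                                         
Definition pp (k n : nat) (C : 'M[R]_(k, n)) (r : 'I_k -> R) (x : M) : Prop :=
  exists y : 'I_n -> M, forall i, \sum_(j < n) C i j *: y j = r i *: x.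

                                                                              
                                                                     
                                                                         
Lemma pp_extension (x m : M) (q : R) :
  (forall k n (C : 'M[R]_(k, n)) r,
     pp C r x -> exists z, pp C r (m + q *: z)) ->
  exists (f : {linear M -> M}) z, f x = m + q *: z.
Proof.
move=> x_m.
pose K : set (M * (M * R^o))%type :=
  [set z | exists r : R, z = (r *: - m, (r *: x, r * - q))]%classic.
have [||u uP] := pure_injective_kill M_pi (K := K).
- split; first by exists 0; rewrite !scale0r mul0r.
  move=> r _ _ [a ->] [b ->]; exists (r * a + b).
  by rewrite !scalerDl !mulrDl -!scalerA -mulrA.
- move=> k n C y a /= /choice[r rP].
  have Kx i : \sum_(j < n) C i j *: (y j).2.1 = r i *: x.
    have /(congr1 (fun z : M * (M * R^o) => z.2.1)) /= := rP i.
    by rewrite subr0 !raddf_sum.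
  have Kq i : \sum_(j < n) C i j * (y j).2.2 = r i * - q.
    have /(congr1 (fun z : M * (M * R^o) => z.2.2)) /= := rP i.
    by rewrite subr0 !raddf_sum.
  have Km i : \sum_(j < n) C i j *: (y j).1 = a i - r i *: m.
    have /(congr1 (fun z : M * (M * R^o) => z.1)) /= := rP i.
    by rewrite !raddf_sum scalerN => <-; rewrite addrC subrK.
  have [|z [l lP]] := x_m _ _ C r; first by exists (fun j => (y j).2.1).
  exists (fun j => (y j).1 + l j + (y j).2.2 *: z) => i.
  under eq_bigr do rewrite !scalerDr scalerA.
  rewrite !big_split /= Km lP -scaler_suml Kq.
  by rewrite mulrN scaleNr scalerDr scalerA addrA subrK addrK.
pose f0 y : M := u (y, 0).
have f0_lin : linear f0.
  move=> r y z; rewrite /f0 -linearP; congr (u _).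
  by congr pair => /=; rewrite scaler0 addr0.
exists (linear_pack f0_lin), (u (0, 1)).
have /= := uP (1 *: - m, (1 *: x, 1 * - q)) (ex_intro _ 1 erefl).
rewrite !scale1r mul1r addrC => /subr0_eq <-.
rewrite /= /f0 -linearZ -linearD /=; congr (u _).
congr pair; rewrite /= ?scaler0 ?addr0 //.
by rewrite /GRing.scale /= mulr1 addNr.
Qed.

End Extension.

                                                                           
                                                                               
                                                                        
Lemma Zorn_transitive (T : Type) (t0 : T) (P : T -> T -> Prop) :
  (forall r s t, P r s -> P s t -> P r t) ->
  (forall A : set T, (exists a, A a) ->
     (forall s t, A s -> A t -> exists u, [/\ A u, P s u & P t u]) ->
     exists t, forall s, A s -> P s t) ->
  exists t, forall s, P t s -> P s t.
Proof.
move=> P_trans P_ub; pose Q s t : bool := `[< s = t \/ P s t >].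
have [t|r s t|A A_tot|t tP] := @ZL_preorder T t0 Q.
- by apply/asboolP; left.
- move=> /asboolP[->//|Prs] /asboolP[<-|Pst]; apply/asboolP; right => //.
  exact: P_trans Pst.
- have [[a Aa]|A0] := pselect (exists a, A a); last first.
    by exists t0 => s As; case: A0; exists s.
  have [[t [At tP]]|A_nomax] :=
      pselect (exists t, A t /\ forall s, A s -> Q s t).
    by exists t.
  have A_next t : A t -> exists u, A u /\ P t u.
    move=> At; apply: contrapT => t_max; apply: A_nomax.
    exists t; split=> // s As.
    have [//|/asboolP[->|Pts]] := A_tot s t As At; first by apply/asboolP; left.
    by case: t_max; exists s.
  have [|s t As At|t tP] := P_ub A; first by exists a.
    have [/asboolP st|/asboolP ts] := A_tot s t As At.
      have [u [Au tu]] := A_next t At; exists u; split=> //.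
      by case: st => [->|st] //; exact: P_trans tu.
    have [u [Au su]] := A_next s As; exists u; split=> //.
    by case: ts => [->|ts] //; exact: P_trans su.
  by exists t => s /tP Pst; apply/asboolP; right.
- exists t => s Pts; have /asboolP[st|//] : Q s t.
    by apply: tP; apply/asboolP; right.
  by rewrite st in Pts *.
Qed.

                               
Section Hull.
Variables (R : idomainType) (M : lmodType R).
Hypothesis M_pi : pure_injective M.
Variables (m : M) (q : R).

Local Notation End := {linear M -> M}.

Definition fixes_mod (f : End) : Prop := exists z, f m = m + q *: z.

Definition factors_through (f g : End) : Prop :=
  exists h : End, forall x, g x = h (f x).

                                                                              
                                                                     
Definition above (b : bool) (f g : End) : Prop :=
  factors_through f g /\ (b -> forall x, g (f x) = f x).

Lemma factors_through_trans f g h :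
  factors_through f g -> factors_through g h -> factors_through f h.
Proof.
by move=> [a aP] [b bP]; exists (b \o a) => x; rewrite bP aP.
Qed.

Lemma above_trans b f g h :
  above b f g -> above b g h -> above b f h.
Proof.
move=> [fg fixg] [gh fixh]; split; first exact: factors_through_trans fg gh.
by move=> bT x; rewrite -(fixg bT) (fixh bT).
Qed.

Lemma fixes_mod_comp (f g : End) :
  fixes_mod f -> fixes_mod g -> fixes_mod (f \o g).
Proof.
move=> [y yP] [z zP]; exists (y + f z).
by rewrite /= zP linearD linearZ yP scalerDr addrA.
Qed.

                                                                          
                                                                                     
                                                                              
Lemma directed_bound (b : bool) (T : choiceType) (t0 : T) (c : T -> End) :
  (forall t, fixes_mod (c t)) ->
  (forall s t, exists u, above b (c s) (c u) /\ above b (c t) (c u)) ->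
  exists h, fixes_mod h /\ forall t, above b (c t) h.
Proof.
move=> c_m c_dir.
have c_fin (s : seq T) : exists u, forall t, t \in s -> above b (c t) (c u).
  elim: s => [|t s [u uP]]; first by exists t0.
  have [u' [tu' uu']] := c_dir t u; exists u' => t'.
  by rewrite inE => /predU1P[->//|/uP tu]; exact: above_trans uu'.
pose sgl t (y : M) : T -> M := fun t' => if t' == t then y else 0.
have sgl_lin t : linear (sgl t).
  move=> r x y; apply/funext => t'.
  rewrite -[RHS]/(r *: sgl t x t' + sgl t y t') /sgl.
  by case: (t' == t) => //; rewrite scaler0 addr0.
                                                                          
                                                                  
pose L : lmodType R := (M * ((T -> M) * R^o))%type.
pose S (s : seq T) : set {linear L -> M} := [set v : {linear L -> M} |
  [/\ forall t, t \in s -> forall x, v (x, (sgl t (- c t x), 0)) = 0,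
      forall t, t \in s -> b -> forall x, v (c t x, 0) = c t x &
      v (m, (0, q)) = m]]%classic.
have [s t|s|v vP] := pure_injective_compact M_pi [::] (S := S).
- exists (s ++ t) => v [v1 v2 v3]; split; split=> // i it.
  + by apply: v1; rewrite mem_cat it.
  + by apply: v2; rewrite mem_cat it.
  + by apply: v1; rewrite mem_cat it orbT.
  + by apply: v2; rewrite mem_cat it orbT.
- have [u uP] := c_fin s.
  have /choice[g gP] t : exists g : End, t \in s -> forall x, c u x = g (c t x).
    have [ts|_] := boolP (t \in s); last by exists (c u).
    by have [[g gP] _] := uP t ts; exists g.
  have [z zP] := c_m u.
  pose G (l : (T -> M)) : M := \sum_(t <- undup s) g t (l t).
  have G_sgl t y : t \in s -> G (sgl t y) = g t y.
    rewrite -mem_undup => ts; rewrite /G (bigD1_seq t) ?undup_uniq //=.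
    rewrite /sgl eqxx big1 ?addr0 // => t' /negPf ->.
    by rewrite linear0.
  pose v (l : L) : M := c u l.1 + G l.2.1 - l.2.2 *: z.
  have v_lin : linear v.
    move=> r x y; rewrite /v /= linearP.
    have -> : G (r *: x.2.1 + y.2.1) = r *: G x.2.1 + G y.2.1.
      rewrite /G scaler_sumr -big_split; apply: eq_bigr => t _ /=.
      exact: (linearP (g t) r (x.2.1 t) (y.2.1 t)).
    have -> : (r *: x.2.2 + y.2.2) *: z = r *: (x.2.2 *: z) + y.2.2 *: z.
      by rewrite scalerDl -scalerA.
    rewrite scalerBr scalerDr opprD [_ + _ + (_ + G _)]addrACA; exact: addrACA.
  exists (linear_pack v_lin); split=> [t ts x|t ts bT x|]; rewrite /= /v /=.
  + by rewrite G_sgl // scale0r subr0 linearN -gP // subrr.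
  + have [_ ->//] := uP t ts; rewrite /G big1 => [|t' _]; last first.
      exact: linear0.
    by rewrite addr0 scale0r subr0.
  + rewrite /G big1 => [|t' _]; last exact: linear0.
    by rewrite addr0 zP addrK.
pose h x : M := v (x, 0).
have h_lin : linear h.
  move=> r x y; rewrite /h -linearP; congr (v _).
  by congr pair => /=; rewrite scaler0 addr0.
exists (linear_pack h_lin); split.
  exists (- v (0, (0, 1))); rewrite /= /h.
  have v_m : v (m, (0, q)) = m by apply: (vP [::]) => ? [].
  rewrite -[RHS](congr1 (+%R^~ _) v_m) scalerN -linearZ -linearB.
  congr (v _); congr pair.
    by rewrite /= scaler0 subr0.
  apply: injective_projections; first by rewrite /= scaler0 subr0.
  by rewrite /= /GRing.scale /= mulr1 subrr.
move=> t; split=> [|bT x] /=; last first.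
  apply: (vP [:: t]) => v' [_ v2 _]; apply: v2 => //; exact: mem_head.
pose g y := v (0, (sgl t y, 0)).
have g_lin : linear g.
  move=> r x y; rewrite /g -linearP; congr (v _).
  congr pair; first by rewrite /= scaler0 addr0.
  by rewrite sgl_lin; congr pair; rewrite /= scaler0 addr0.
exists (linear_pack g_lin) => x /=; apply/eqP; rewrite -subr_eq0 /h /g -linearB.
apply/eqP; apply: (vP [:: t]) => v' [v1 _ _].
rewrite -[RHS](v1 t (mem_head _ _) x); congr (v' _).
congr pair; first by rewrite /= subr0.
congr pair; last by rewrite /= subr0.
apply/funext => t1; rewrite -[LHS]/(0 - (if t1 == t then c t x else 0)) /sgl.
by case: ifP => _; rewrite ?sub0r ?oppr0.
Qed.

Lemma directed_set_bound b (P : End -> Prop) (A : set {f | P f}) :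
  (forall f, P f -> fixes_mod f) -> (exists a, A a) ->
  (forall s t, A s -> A t ->
      exists u,
        [/\ A u, above b (sval s) (sval u) & above b (sval t) (sval u)]) ->
  exists h, fixes_mod h /\ forall t, A t -> above b (sval t) h.
Proof.
move=> P_m [a Aa] A_dir.
pose T := {classic {f : {f | P f} | A f}}.
have [||h [h_m hP]] :=
  @directed_bound b T (exist _ a Aa) (fun t => sval (sval t)).
- by move=> t; apply: P_m; exact: svalP.
- move=> [s As] [t At]; have [u [Au su tu]] := A_dir s t As At.
  by exists (exist _ u Au).
- by exists h; split=> // t At; exact: hP (exist _ t At).
Qed.

                                                                                 
                                                                            
                                                                               
                                                                         
Lemma maximal_idempotent : exists e : End,
  [/\ fixes_mod e, forall x, e (e x) = e x &
      forall g, fixes_mod g -> factors_through e g -> factors_through g e].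
Proof.
have id_m : fixes_mod idfun by exists 0; rewrite scaler0 addr0.
have [|A A_ex A_dir|[f f_m] /= f_max] := @Zorn_transitive {f | fixes_mod f}
    (exist _ _ id_m) (fun f g => above false (sval f) (sval g)).
- by move=> r s t; exact: above_trans.
- have [//|h [h_m hP]] := directed_set_bound _ A_ex A_dir.
  by exists (exist _ h h_m).
pose P g := fixes_mod g /\ factors_through f g.
have Pf : P f by split=> //; exists idfun.
have [|A A_ex A_dir|[e [e_m fe]] /= e_max] := @Zorn_transitive {f | P f}
    (exist _ _ Pf) (fun f g => above true (sval f) (sval g)).
- by move=> r s t; exact: above_trans.
- have [g []//|h [h_m hP]] := directed_set_bound _ A_ex A_dir.
  have Ph : P h.
    split=> //; have [a Aa] := A_ex; have [_ fa] := svalP a.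
    exact: factors_through_trans fa (hP a Aa).1.
  by exists (exist _ h Ph).
have e_maximal g : fixes_mod g -> factors_through e g -> factors_through g e.
  move=> g_m eg; have fg : above false f g.
    by split=> //; exact: factors_through_trans fe eg.
  have [gf _] := f_max (exist _ g g_m) fg.
  exact: factors_through_trans gf fe.
have [g gP] : factors_through (e \o e) e.
  by apply: e_maximal; [exact: fixes_mod_comp | exists e].
have g_m : fixes_mod g.
  have [z zP] := fixes_mod_comp e_m e_m; have [y yP] := e_m.
  exists (y - g z); apply/eqP.
  rewrite -(inj_eq (addIr (q *: g z))) -linearZ -linearD.
  by rewrite -zP -gP yP -addrA linearZ -scalerDr subrK.
                                                       
have e1_m : fixes_mod (g \o e) by exact: fixes_mod_comp.
have P1 : P (g \o e).
  by split=> //; apply: (factors_through_trans fe); exists g.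
have [|_ /(_ isT) e_e1] := e_max (exist _ _ P1).
  by split; [exists g | move=> _ x; rewrite /= -gP].
exists e; split=> // x.
by have := e_e1 (e x); rewrite /= -gP.
Qed.

End Hull.

                                                              
Section Indecomposable.
Variables (R : idomainType) (M : lmodType R).
Local Notation End := {linear M -> M}.

Lemma submod_closedP (A : set M) : submod_closed (mem A) <-> submodule A.
Proof.
split=> -[A0 AD]; split.
- by rewrite inE in A0.
- by move=> r x y Ax Ay; have := AD r x y; rewrite !inE; apply.
- by rewrite inE.
- by move=> r x y; rewrite !inE; exact: AD.
Qed.

Lemma submoduleB (A : set M) x y : submodule A -> A x -> A y -> A (x - y).
Proof. by move=> [_ AD] Ax Ay; rewrite addrC -scaleN1r; exact: AD. Qed.

                                                                   
Lemma projection_onto (e : End) (A B : set M) :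
  (forall x, e (e x) = e x) -> direct_sum [set x | e x = x]%classic A B ->
  exists f : End, [/\ forall x, B (e x - f x), forall a, A a -> f a = a,
    forall b, B b -> f b = 0 & forall x, f (e x) = f x].
Proof.
move=> ee [/submod_closedP A_sub /submod_closedP B_sub N_AB AB0].
have e_AB a b : A a -> B b -> e (a + b) = a + b.
  move=> Aa Bb; suff : [set x | e x = x]%classic (a + b) by [].
  by rewrite N_AB; exists a, b.
have /choice[f fP] x : exists a, A a /\ B (e x - a).
  have : [set x | e x = x]%classic (e x) by exact: ee.
  by rewrite N_AB => -[a [b [Aa Bb ->]]]; exists a; rewrite addrC addKr.
have f_uniq x a : A a -> B (e x - a) -> f x = a.
  move=> Aa Ba; have [Af Bf] := fP x; apply/subr0_eq.
  suff : ([set 0] (f x - a))%classic by [].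
  rewrite -AB0; split; first exact: submoduleB.
  have -> : f x - a = (e x - a) - (e x - f x).
    by rewrite opprB [RHS]addrC addrA subrK.
  exact: submoduleB.
have f_lin : linear f.
  move=> r x y; have [Ax Bx] := fP x; have [Ay By] := fP y.
  apply: f_uniq; first exact: A_sub.2.
  by rewrite linearP opprD addrACA -scalerBr; exact: B_sub.2.
exists (linear_pack f_lin); split=> [x|a Aa|b Bb|x] /=.
- exact: (fP x).2.
- apply: f_uniq => //.
  by rewrite -[a in e a]addr0 e_AB ?addr0 ?subrr //; exact: B_sub.1.
- apply: f_uniq; first exact: A_sub.1.
  by rewrite -[b in e b]add0r e_AB ?add0r ?subr0 //; exact: A_sub.1.
- by have [Ax Bx] := fP x; apply: f_uniq; rewrite ?ee.
Qed.

                                                                         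
                                    
Definition pp_chain (w q : R) : Prop :=
  forall k n (C : 'M[R]_(k, n)) r k' n' (C' : 'M[R]_(k', n')) r',
    (forall x : M, w *: x = 0 -> pp C r x -> exists z, pp C' r' (x + q *: z)) \/
    (forall x : M, w *: x = 0 -> pp C' r' x -> exists z, pp C r (x + q *: z)).

Lemma ppD k n (C : 'M[R]_(k, n)) r (x y : M) :
  pp C r x -> pp C r y -> pp C r (x + y).
Proof.
move=> [a aP] [b bP]; exists (fun j => a j + b j) => i.
by under eq_bigr do rewrite scalerDr; rewrite big_split /= aP bP scalerDr.
Qed.

Hypothesis M_pi : pure_injective M.

                                                                               
                                                                         
                                                   
Lemma pp_chain_extension (w q : R) (m x y : M) : pp_chain w q ->
  w *: x = 0 -> w *: y = 0 -> (exists z, x + y = m + q *: z) ->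
  (exists (f : End) z, f x = m + q *: z) \/
  (exists (f : End) z, f y = m + q *: z).
Proof.
move=> w_q wx wy [z0 xy].
have [x_m|/existsNP[k /existsNP[n /existsNP[C]]] /existsNP[r]
    /not_implyP[Cx Cm]] :=
  pselect (forall k n (C : 'M[R]_(k, n)) r,
             pp C r x -> exists z, pp C r (m + q *: z)).
  by left; exact: pp_extension.
have [y_m|/existsNP[k' /existsNP[n' /existsNP[C']]] /existsNP[r']
    /not_implyP[Cy Cm']] :=
  pselect (forall k n (C : 'M[R]_(k, n)) r,
             pp C r y -> exists z, pp C r (m + q *: z)).
  by right; exact: pp_extension.
have [CC'|C'C] := w_q _ _ C r _ _ C' r'.
  case: Cm'; have [z zP] := CC' x wx Cx.
  exists (z0 + z); rewrite scalerDr addrA -xy addrAC; exact: ppD.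
case: Cm; have [z zP] := C'C y wy Cy.
exists (z0 + z); rewrite scalerDr addrA -xy -addrA; exact: ppD.
Qed.

                                                                              
                                                                            
                                                              
Lemma indecomposable_summand (w q : R) (m : M) : pp_chain w q ->
  w *: m = 0 -> ~ (exists z, m = q *: z) ->
  exists N : set M, direct_summand N /\ indecomposable N.
Proof.
move=> w_q wm m_q; have [e [e_m ee e_max]] := maximal_idempotent M_pi m q.
exists [set x | e x = x]%classic; split; [|split].
- exists [set x | e x = 0]%classic; split.
  + apply/submod_closedP; split=> [|r x y ex ey] /=; first exact: linear0.
    by rewrite linearP ex ey.
  + apply/submod_closedP; split=> [|r x y ex ey] /=; first exact: linear0.
    by rewrite linearP ex ey scaler0 addr0.
  + apply/seteqP; split=> // x _; exists (e x), (x - e x).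
    by rewrite /= linearB ee subrr [e x + _]addrC subrK.
  + apply/seteqP; split=> [x [/= -> ->]|_ ->] //.
    by split; rewrite /= linear0.
- move=> N0; case: m_q; have [z zP] := e_m.
  have : [set x | e x = x]%classic (e m) by exact: ee.
  rewrite N0 /= zP => /eqP; rewrite addr_eq0 -scalerN => /eqP.
  by exists (- z).
have kill (f : End) (B : set M) : B 0 -> (forall b, B b -> e b = b) ->
    (forall b, B b -> f b = 0) -> (forall x, f (e x) = f x) ->
    (exists (k : End) z, k (f m) = m + q *: z) -> B = [set 0]%classic.
  move=> B0 eB fB fe [k [z kP]].
  have [||g gP] := e_max (k \o f); first by exists z.
    by exists (k \o f) => x /=; rewrite fe.
  apply/seteqP; split=> [b Bb|_ ->] //=.
  by rewrite -(eB b Bb) gP /= fB // !linear0.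
move=> A B AB; have [f [fB fA f0 fe]] := projection_onto ee AB.
have [/submod_closedP A_sub /submod_closedP B_sub N_AB _] := AB.
have eA a : A a -> e a = a.
  move=> Aa; suff : [set x | e x = x]%classic a by [].
  by rewrite N_AB; exists a, 0; rewrite addr0; split=> //; exact: B_sub.1.
have eB b : B b -> e b = b.
  move=> Bb; suff : [set x | e x = x]%classic b by [].
  by rewrite N_AB; exists 0, b; rewrite add0r; split=> //; exact: A_sub.1.
have g_lin : linear (fun x => e x - f x).
  by move=> r x y; rewrite (linearP e) (linearP f) opprD addrACA scalerBr.
pose g := linear_pack g_lin.
have [|||m_f|m_g] := @pp_chain_extension w q m (f m) (g m) w_q.
- by rewrite -linearZ wm linear0.
- by rewrite -linearZ wm linear0.
- by have [z zP] := e_m; exists z; rewrite /= addrC subrK.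
- by right; apply: kill m_f => //; exact: B_sub.1.
- left; apply: kill m_g => [|//|a Aa|x] /=; first exact: A_sub.1.
  + by rewrite eA // fA // subrr.
  + by rewrite ee fe.
Qed.

End Indecomposable.

                                    
Section Invertible.
Variables (R : idomainType) (M : lmodType R).

Definition acts_bijectively (t : R) : Prop := bijective (fun x : M => t *: x).

Local Notation T := acts_bijectively.

Lemma acts_inj t (x y : M) : T t -> t *: x = t *: y -> x = y.
Proof. by move=> /bij_inj t_inj; exact: t_inj. Qed.

Lemma acts_surj t (x : M) : T t -> exists y, x = t *: y.
Proof. by move=> [g _ gK]; exists (g x); rewrite gK. Qed.

Lemma acts_bij t : (forall x : M, t *: x = 0 -> x = 0) ->
  (forall x : M, exists y, x = t *: y) -> T t.
Proof.
move=> t_inj /choice[g gP]; exists g => x; last by rewrite -gP.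
by apply/subr0_eq/t_inj; rewrite scalerBr -gP subrr.
Qed.

Lemma actsM s t : T s -> T t -> T (s * t).
Proof.
move=> Ts Tt; apply: acts_bij => x.
  move=> stx; apply: (acts_inj Tt); apply: (acts_inj Ts).
  by rewrite scalerA stx !scaler0.
have [y ->] := acts_surj x Ts; have [z ->] := acts_surj y Tt.
by exists z; rewrite scalerA.
Qed.

Lemma acts_divl s t : T (s * t) -> T s.
Proof.
move=> Tst; apply: acts_bij => x.
  move=> sx; apply: (acts_inj Tst).
  by rewrite mulrC -scalerA sx !scaler0.
by have [y ->] := acts_surj x Tst; exists (t *: y); rewrite scalerA.
Qed.

Lemma acts1 : T 1.
Proof. by exists id => x; rewrite scale1r. Qed.

                                                                               
              
Definition local_pred (P : M -> Prop) : Prop :=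
  (forall c x, P x -> P (c *: x)) /\ (forall t x, T t -> P (t *: x) -> P x).

Lemma local_pp k n (C : 'M[R]_(k, n)) r : local_pred (pp C r).
Proof.
split=> [c x [y yP]|t x Tt [y yP]].
  exists (fun j => c *: y j) => i.
  rewrite scalerA mulrC -scalerA -yP scaler_sumr.
  by apply: eq_bigr => j _; rewrite !scalerA mulrC.
have /choice[z zP] j := acts_surj (y j) Tt.
exists z => i; apply: (acts_inj Tt).
rewrite scalerA mulrC -scalerA -yP scaler_sumr.
by apply: eq_bigr => j _; rewrite scalerA mulrC -scalerA -zP.
Qed.

Lemma local_image D : local_pred (fun x => exists y, x = D *: y).
Proof.
split=> [c x [y ->]|t x Tt [y xy]].
  by exists (c *: y); rewrite !scalerA mulrC.
have [z yz] := acts_surj y Tt; exists z; apply: (acts_inj Tt).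
by rewrite xy yz !scalerA mulrC.
Qed.

Lemma local_kernel a : local_pred (fun x => a *: x = 0).
Proof.
split=> [c x ax|t x Tt]; first by rewrite scalerA mulrC -scalerA ax scaler0.
by move=> atx; apply: (acts_inj Tt); rewrite scalerA mulrC -scalerA atx scaler0.
Qed.

End Invertible.

                                                             
Section LocalAlgebra.
Variables (R : idomainType) (M : lmodType R).
Hypothesis R_bezout : bezout_domain R.

Local Notation T := (@acts_bijectively R M).

Lemma bezout2 (a b : R) : exists d a' b',
  [/\ a = a' * d, b = b' * d & exists u v, d = u * a + v * b].
Proof.
have [d /seteqP[sub sup]] :=
  R_bezout (fun i : 'I_2 => if i == ord0 then a else b).
have ab c0 c1 : exists c : 'I_2 -> R, c0 * a + c1 * b =
    \sum_(i < 2) c i * (if i == ord0 then a else b).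
  exists (fun i => if i == ord0 then c0 else c1).
  by rewrite !big_ord_recl big_ord0 addr0.
have [a' a'P] : exists c, 1 * a + 0 * b = c * d by apply: sub; exact: ab.
have [b' b'P] : exists c, 0 * a + 1 * b = c * d by apply: sub; exact: ab.
have [c cP] := sup d (ex_intro _ 1 (esym (mul1r d))).
exists d, a', b'; split; first by rewrite -a'P; ring.
  by rewrite -b'P; ring.
exists (c ord0), (c (lift ord0 ord0)).
by rewrite {1}cP !big_ord_recl big_ord0 addr0.
Qed.

Variable p : R.
                                                      
Hypothesis p_notT : ~ T p.
Hypothesis p_max : forall x,
  (exists t c, T t /\ t * x = c * p) \/ (exists u v, T (u * x + v * p)).

                                                                                 
                                             
Definition unit_mod (s : R) : Prop := exists u v, T (u * s + v * p).

Lemma unit_mod1 : unit_mod 1.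
Proof. by exists 1, 0; rewrite mul1r mul0r addr0; exact: acts1. Qed.

Lemma unit_modM s s' : unit_mod s -> unit_mod s' -> unit_mod (s * s').
Proof.
move=> [u [v uv]] [u' [v' uv']].
exists (u * u'), (v * (u' * s' + v' * p) + u * s * v').
have -> : u * u' * (s * s') + (v * (u' * s' + v' * p) + u * s * v') * p =
  (u * s + v * p) * (u' * s' + v' * p) by ring.
exact: actsM.
Qed.

                                                                                
                                                                                 
                                
Lemma local_divides a b :
  exists s, unit_mod s /\
    ((exists c, s * a = c * b) \/ (exists c, s * b = c * a)).
Proof.
have [d [a' [b' [-> -> [u [v duv]]]]]] := bezout2 a b.
have [d0|d0] := eqVneq d 0.
  by exists 1; split; [exact: unit_mod1 | left; exists 0; rewrite d0; ring].
have uv1 : u * a' + v * b' = 1.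
  by apply: (mulIf d0); rewrite mul1r [RHS]duv; ring.
have [[s [c [Ts sa]]]|a'_unit] := p_max a'; last first.
  by exists a'; split=> //; right; exists b'; ring.
have [[t [c' [Tt tb]]]|b'_unit] := p_max b'; last first.
  by exists b'; split=> //; left; exists a'; ring.
case: p_notT; apply: (@acts_divl _ _ _ (u * c * t + v * c' * s)).
have -> : p * (u * c * t + v * c' * s) = s * t * (u * a' + v * b').
  have -> : s * t * (u * a' + v * b') =
    u * t * (s * a') + v * s * (t * b') by ring.
  by rewrite sa tb; ring.
by rewrite uv1 mulr1; exact: actsM.
Qed.

Lemma local_minimum (l : seq R) : l = [::] \/
  exists d s, [/\ d \in l, unit_mod s &
    forall c, c \in l -> exists e, s * c = e * d].
Proof.
elim: l => [|x l [->|[d [s [dl s_unit sd]]]]]; first by left.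
  right; exists x, 1; split; [exact: mem_head | exact: unit_mod1 |].
  by move=> c; rewrite inE => /eqP ->; exists 1.
right; have [t [t_unit [[e xe]|[e de]]]] := local_divides x d.
  exists d, (s * t); split; [by rewrite inE dl orbT | exact: unit_modM |].
  move=> c; rewrite inE => /predU1P[->|/sd[f fP]].
    by exists (s * e); rewrite -mulrA xe mulrA.
  by exists (t * f); rewrite -mulrA [t * c]mulrC mulrA fP; ring.
exists x, (s * t); split; [exact: mem_head | exact: unit_modM |].
move=> c; rewrite inE => /predU1P[->|/sd[f fP]]; first by exists (s * t).
exists (f * e); have -> : s * t * c = t * (s * c) by ring.
by rewrite fP -mulrA -de; ring.
Qed.

                                                                                  
                                                               
Definition satisfies (l : seq (R * R)) (x : M) : Prop :=
  forall ad, ad \in l -> exists y, ad.1 *: x = ad.2 *: y.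

Lemma satisfiesZ l c x : satisfies l x -> satisfies l (c *: x).
Proof.
move=> lx ad /lx[y yP]; exists (c *: y).
by rewrite !scalerA ![_ * c]mulrC -!scalerA yP.
Qed.

Lemma satisfies_cons a d l x :
  satisfies ((a, d) :: l) x <-> (exists y, a *: x = d *: y) /\ satisfies l x.
Proof.
split=> [lx|[ax lx] ad]; last by rewrite inE => /predU1P[->|/lx].
split; first exact: (lx (a, d) (mem_head _ _)).
by move=> ad adl; apply: lx; rewrite inE adl orbT.
Qed.

                                                                              
                                                                                
                                                                                 
                                                                                
                                                                               
                                                                                 
                                        
Lemma pp_normal_form k n (C : 'M[R]_(k, n)) (r : 'I_k -> R) :
  exists l, forall x, (pp C r x -> satisfies l x) /\
    (satisfies l x -> exists s, unit_mod s /\ pp C r (s *: x)).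
Proof.
have [N] := ubnP #|[set j | [exists i, C i j != 0]]|.
elim: N C r => // N IH C r CN.
have [E0|[d [s [dE s_unit sd]]]] :=
    local_minimum [seq c <- [seq C ij.1 ij.2 | ij : 'I_k * 'I_n] | c != 0].
  have C0 i j : C i j = 0.
    apply: contraTeq isT => Cij.
    have : C i j \in [seq c <- [seq C ij.1 ij.2 | ij : 'I_k * 'I_n] | c != 0].
      by rewrite mem_filter Cij /=; apply/fintype.imageP; exists (i, j).
    by rewrite E0.
  exists [seq (r i, 0) | i : 'I_k] => x; split.
    move=> [y yP] _ /fintype.imageP[i _ ->]; exists 0.
    by rewrite -yP big1 ?scaler0 // => j _; rewrite C0 scale0r.
  move=> lx; exists 1; split; first exact: unit_mod1.
  exists (fun=> 0) => i; rewrite scale1r.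
  have [|y /= ->] := lx (r i, 0); first by apply/fintype.imageP; exists i.
  by rewrite scale0r big1 // => j _; rewrite scaler0.
move: dE; rewrite mem_filter => /andP[d0 /fintype.imageP[[i0 j0] _ /= dE]].
have /choice[c0 c0P] ij : exists e, s * C ij.1 ij.2 = e * d.
  have [->|Cij] := eqVneq (C ij.1 ij.2) 0.
    by exists 0; rewrite mulr0 mul0r.
  by apply: sd; rewrite mem_filter Cij /=; apply/fintype.imageP; exists ij.
pose c i j := c0 (i, j).
have cP i j : d * c i j = s * C i j by rewrite mulrC -(c0P (i, j)).
have c_piv : c i0 j0 = s.
  by apply: (mulfI d0); rewrite cP -dE mulrC.
pose C' : 'M[R]_(k, n) := \matrix_(i, j) (d * (s * c i j - c i j0 * c i0 j)).
pose r' i := s * s * r i - s * c i j0 * r i0.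
have C'E (y : 'I_n -> M) i : \sum_j C' i j *: y j =
    (s * s) *: (\sum_j C i j *: y j) - (s * c i j0) *: (\sum_j C i0 j *: y j).
  rewrite !scaler_sumr -sumrB; apply: eq_bigr => j _.
  rewrite mxE !scalerA -scalerBl; congr (_ *: _).
  by rewrite mulrBr mulrCA cP [d * (_ * _)]mulrCA cP; ring.
have [|l lP] := IH C' r'.
  rewrite -ltnS; apply: leq_trans CN; rewrite ltnS.
  apply/proper_card/fintype.properP; split.
    apply/fintype.subsetP => j; rewrite !inE => /existsP[i C'ij].
    apply: contraTT C'ij; rewrite negb_exists => /forallP Cj.
    have cj i1 : c i1 j = 0.
      apply: (mulfI d0); rewrite cP mulr0.
      by have /negPn/eqP -> := Cj i1; rewrite mulr0.
    by rewrite mxE !cj !mulr0 subr0 mulr0 negbK.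
  exists j0; rewrite !inE; first by apply/existsP; exists i0; rewrite -dE.
  rewrite negb_exists; apply/forallP => i; rewrite negbK mxE c_piv.
  by apply/eqP; ring.
exists ((s * r i0, d) :: l) => x; split.
  move=> [y yP] ad; rewrite inE => /predU1P[->/=|].
    exists (\sum_j c i0 j *: y j).
    rewrite -scalerA -yP !scaler_sumr; apply: eq_bigr => j _.
    by rewrite !scalerA cP.
  apply: (lP x).1; exists y => i.
  by rewrite C'E !yP !scalerA -scalerBl.
move=> lx; have [|s1 [s1_unit [y yP]]] := (lP x).2.
  by move=> ad adl; apply: lx; rewrite inE adl orbT.
have [z /= zP] : exists z, (s * r i0) *: (s1 *: x) = d *: z.
  exact: (satisfiesZ s1 lx (mem_head (s * r i0, d) l)).
exists (s * s * s1); split; first by do 2!apply: unit_modM => //.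
pose z' := z - \sum_j c i0 j *: y j.
                                                                            
                                                                   
pose Y j := s *: y j + (if j == j0 then z' else 0).
exists (fun j => s *: Y j) => i.
have CY : \sum_j C i j *: (s *: Y j) = d *: \sum_j c i j *: Y j.
  by rewrite scaler_sumr; apply: eq_bigr => j _; rewrite !scalerA cP mulrC.
rewrite CY.
have -> : \sum_j c i j *: Y j =
    s *: (\sum_j c i j *: y j) + c i j0 *: z'.
  under eq_bigr do rewrite scalerDr.
  rewrite big_split /= scaler_sumr; congr (_ + _).
    by apply: eq_bigr => j _; rewrite !scalerA mulrC.
  rewrite (bigD1 j0) //= eqxx big1 ?addr0 // => j /negPf ->.
  by rewrite scaler0.
have C'y : \sum_j C' i j *: y j =
    (d * s) *: (\sum_j c i j *: y j) - (d * c i j0) *: (\sum_j c i0 j *: y j).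
  rewrite !scaler_sumr -sumrB; apply: eq_bigr => j _.
  by rewrite mxE !scalerA -scalerBl; congr (_ *: _); ring.
rewrite scalerDr /z' !scalerBr !scalerA addrCA addrC -addrA.
rewrite addrA -C'y yP [d * c i j0]mulrC -[(_ * d) *: z]scalerA.
rewrite -zP !scalerA -scalerDl.
by congr (_ *: _); rewrite /r'; ring.
Qed.

                                                                         
                                                 
Lemma local_pred_socle P s (x : M) : local_pred P -> unit_mod s ->
  p *: x = 0 -> P (s *: x) -> P x.
Proof.
move=> [P_scale P_div] [u [v Tuv]] px Psx; apply: (P_div _ _ Tuv).
by rewrite scalerDl -!scalerA px scaler0 addr0; exact: P_scale.
Qed.

                                                                   
Lemma local_pred_top P s (x z : M) : local_pred P -> unit_mod s ->
  P (s *: x + p *: z) -> exists z', P (x + p *: z').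
Proof.
move=> [P_scale P_div] [u [v Tuv]] Psx.
have [z' z'P] := acts_surj (u *: z - v *: x) Tuv.
exists z'; apply: (P_div _ _ Tuv); rewrite scalerDr.
have -> : (u * s + v * p) *: (p *: z') = p *: (u *: z - v *: x).
  by rewrite z'P !scalerA mulrC.
suff -> : (u * s + v * p) *: x + p *: (u *: z - v *: x) =
    u *: (s *: x + p *: z).
  exact: P_scale.
rewrite scalerDl scalerBr scalerDr !scalerA [p * v]mulrC [p * u]mulrC.
by rewrite addrACA subrr addr0.
Qed.

                                                                            
                                                                                
                                                                                
                                                  
Lemma pp_socle k n (C : 'M[R]_(k, n)) r : exists D : R,
  forall x : M, p *: x = 0 -> (pp C r x <-> exists y, x = D *: y).
Proof.
have [l lP] := pp_normal_form C r.
suff [D DP] : exists D : R, forall x : M, p *: x = 0 ->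
    (satisfies l x <-> exists y, x = D *: y).
  exists D => x px; rewrite -DP //.
  split=> [/(lP x).1//|/(lP x).2[s [s_unit sx]]].
  exact: local_pred_socle (local_pp _ C r) s_unit px sx.
elim: l {lP} => [|[a d] l [D DP]].
  by exists 1 => x px; split=> // _; exists x; rewrite scale1r.
have [[t [c [Tt ta]]]|[u [v Tuv]]] := p_max a.
  exists D => x px; rewrite satisfies_cons -DP //; split=> [[]//|]; split=> //.
  exists 0; rewrite scaler0; apply: (acts_inj Tt).
  by rewrite scalerA ta -scalerA px !scaler0.
have ax_d (x : M) : p *: x = 0 ->
    (exists y, a *: x = d *: y) <-> (exists y, x = d *: y).
  move=> px; split=> [[y yP]|[y ->]].
    apply: (local_pred_socle (local_image M d) (s := a) _ px).
      by exists u, v.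
    by exists y.
  by exists (a *: y); rewrite !scalerA mulrC.
have [s [s_unit [[c sd]|[c sD]]]] := local_divides d D.
  exists d => x px; rewrite satisfies_cons ax_d // DP //.
  split=> [[]//|dx]; split=> //.
  apply: (local_pred_socle (local_image M D) s_unit px).
  by have [y ->] := dx; exists (c *: y); rewrite !scalerA sd mulrC.
exists D => x px; rewrite satisfies_cons ax_d // DP //.
split=> [[]//|Dx]; split=> //.
apply: (local_pred_socle (local_image M d) s_unit px).
by have [y ->] := Dx; exists (c *: y); rewrite !scalerA sD mulrC.
Qed.

                                                                                
                                                                             
                                                                        
                                                                          
                                               
Lemma pp_top k n (C : 'M[R]_(k, n)) r : exists a : R,
  forall x : M,
    (exists z, pp C r (x + p *: z)) <-> exists z, a *: (x + p *: z) = 0.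
Proof.
have [l lP] := pp_normal_form C r.
suff [a aP] : exists a : R, forall x : M,
    (satisfies l x -> exists z, a *: (x + p *: z) = 0) /\
    (a *: x = 0 -> exists s, unit_mod s /\ satisfies l (s *: x)).
  exists a => x.
  split=> [[z /(lP _).1/(aP _).1[z' z'P]]|[z /(aP _).2[s [s_unit]]]].
    by exists (z + z'); rewrite [p *: _]scalerDr addrA.
  move=> /(lP _).2[s' [s'_unit]]; rewrite scalerA scalerDr => Cx.
  have ss'_unit := unit_modM s'_unit s_unit.
  apply: (local_pred_top (local_pp M C r) ss'_unit (z := (s' * s) *: z)).
  by rewrite [p *: _]scalerA [p * _]mulrC -[(s' * s * p) *: z]scalerA.
elim: l {lP} => [|[b d] l [a aP]].
  exists 0 => x; split=> [_|_]; first by exists 0; rewrite scale0r.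
  by exists 1; split=> //; exact: unit_mod1.
                                                                        
have keep_a s c : unit_mod s -> s * b = c * d ->
    exists a : R, forall x : M,
    (satisfies ((b, d) :: l) x -> exists z, a *: (x + p *: z) = 0) /\
    (a *: x = 0 -> exists s, unit_mod s /\ satisfies ((b, d) :: l) (s *: x)).
  move=> s_unit sb; exists a => x; split=> [/satisfies_cons[_ /(aP x).1]//|].
  move=> /(aP x).2[s' [s'_unit lx]].
  exists (s * s'); split; first exact: unit_modM.
  rewrite -scalerA satisfies_cons; split; last exact: satisfiesZ.
  exists (c *: (s' *: x)).
  by rewrite scalerA [RHS]scalerA [b * s]mulrC sb [c * d]mulrC.
have [s [s_unit [[c sb]|[e sd]]]] := local_divides b d.
  exact: keep_a s_unit sb.
have [[t [c [Tt te]]]|e_unit] := p_max e; last first.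
  by apply: (keep_a e s); rewrite // mulrC [RHS]mulrC sd.
have t_unit : unit_mod t by exists 1, 0; rewrite mul1r mul0r addr0.
have b_top (x : M) :
    (exists y, b *: x = d *: y) -> exists z, b *: (x + p *: z) = 0.
  move=> [y yP].
  have ts_unit := unit_modM t_unit s_unit.
  apply: (local_pred_top (local_kernel M b) ts_unit (z := - (c *: y))).
  rewrite scalerN scalerBr !scalerA.
  have -> : b * (t * s) = t * s * b by ring.
  rewrite -[(t * s * b) *: x]scalerA yP scalerA -scalerBl.
  have -> : b * p * c = b * (c * p) by ring.
  have -> : b * (c * p) = t * (e * b) by rewrite -te; ring.
  by rewrite -mulrA sd subrr scale0r.
have [s' [s'_unit [[f sb]|[f sa]]]] := local_divides b a.
  exists a => x; split=> [/satisfies_cons[_ /(aP x).1]//|ax].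
  have /(aP _).2[s1 [s1_unit lx]] : a *: (s' *: x) = 0.
    by rewrite scalerA mulrC -scalerA ax scaler0.
  exists (s1 * s'); split; first exact: unit_modM.
  rewrite -scalerA satisfies_cons; split=> //.
  exists 0; rewrite scaler0 !scalerA.
  have -> : b * s1 * s' = s1 * (s' * b) by ring.
  by rewrite sb mulrA -scalerA ax scaler0.
exists b => x; split=> [/satisfies_cons[/b_top//]|bx].
have /(aP _).2[s1 [s1_unit lx]] : a *: (s' *: x) = 0.
  by rewrite scalerA mulrC sa -scalerA bx scaler0.
exists (s1 * s'); split; first exact: unit_modM.
rewrite -scalerA satisfies_cons; split=> //; exists 0; rewrite scaler0 !scalerA.
by rewrite -mulrA mulrC -scalerA bx scaler0.
Qed.

Lemma pp_chain_socle : pp_chain M p 0.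
Proof.
move=> k n C r k' n' C' r'.
have [D DP] := pp_socle C r; have [D' D'P] := pp_socle C' r'.
have step D1 D2 c s (x : M) : unit_mod s -> p *: x = 0 -> s * D1 = c * D2 ->
    (exists y, x = D1 *: y) -> exists y, x = D2 *: y.
  move=> s_unit px sD [y xy].
  apply: (local_pred_socle (local_image M D2) s_unit px).
  by exists (c *: y); rewrite xy !scalerA sD mulrC.
have [s [s_unit [[c sD]|[c sD]]]] := local_divides D D'.
  left=> x px /(DP _ px)Dx; exists 0; rewrite scaler0 addr0.
  exact/(D'P _ px)/(step D D' c s).
right=> x px /(D'P _ px)Dx; exists 0; rewrite scaler0 addr0.
exact/(DP _ px)/(step D' D c s).
Qed.

Lemma pp_chain_top : pp_chain M 0 p.
Proof.
move=> k n C r k' n' C' r'.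
have [a aP] := pp_top C r; have [a' a'P] := pp_top C' r'.
have step a1 a2 c s (x : M) : unit_mod s -> s * a2 = c * a1 ->
    (exists z, a1 *: (x + p *: z) = 0) -> exists z, a2 *: (x + p *: z) = 0.
  move=> s_unit sa [z az].
  apply: (local_pred_top (local_kernel M a2) s_unit (z := s *: z)).
  rewrite [p *: _]scalerA [p * s]mulrC -[(s * p) *: z]scalerA -scalerDr.
  by rewrite scalerA [a2 * s]mulrC sa -scalerA az scaler0.
have pp0 k1 n1 (C1 : 'M[R]_(k1, n1)) r1 (x : M) :
    pp C1 r1 x -> exists z, pp C1 r1 (x + p *: z).
  by exists 0; rewrite scaler0 addr0.
have [s [s_unit [[c sa]|[c sa]]]] := local_divides a a'.
  by right=> x _ /pp0/a'P xa; apply/aP/(step a' a c s).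
by left=> x _ /pp0/aP xa; apply/a'P/(step a a' c s).
Qed.

End LocalAlgebra.

                                                 
Section Superdecomposable.
Variables (R : idomainType) (M : lmodType R).
Hypothesis R_bezout : bezout_domain R.
Hypothesis M_sd : superdecomposable M.
Hypothesis M_pi : pure_injective M.
Local Notation T := (@acts_bijectively R M).
Local Notation "x %:F" := (@FracField.tofrac R x).

Lemma locally_maximal_acts_bijectively (p : R) :
  (forall x, (exists t c, T t /\ t * x = c * p) \/
             (exists u v, T (u * x + v * p))) ->
  T p.
Proof.
move=> p_max; apply: contrapT => p_notT; apply: M_sd.2.
have [p_inj|/existsNP[m /not_implyP[pm /eqP m0]]] :=
    pselect (forall m : M, p *: m = 0 -> m = 0); last first.
  have p_chain := pp_chain_socle R_bezout p_notT p_max.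
  apply: (indecomposable_summand M_pi p_chain pm).
  by move=> [z]; rewrite scale0r => /eqP; rewrite (negPf m0).
have [p_surj|/existsNP[m pm]] := pselect (forall m : M, exists y, m = p *: y).
  by case: p_notT; exact: acts_bij.
have p_chain := pp_chain_top R_bezout p_notT p_max.
apply: (indecomposable_summand M_pi p_chain _ pm).
exact: scale0r.
Qed.

Lemma acts_neq0 t : T t -> t != 0.
Proof.
move=> Tt; apply/eqP => t0; have [m m0] := M_sd.1; apply: m0.
by apply: (acts_inj Tt); rewrite t0 !scale0r.
Qed.

                                                                             
                                                                                
                                                                            
                     
Lemma irreducible_acts_bijectively (S : set R) (p : {fraction R}) :
  (S `<=` T)%classic -> irreducible_in (localisation S) p ->
  exists a t, [/\ T a, T t & p = a%:F / t%:F].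
Proof.
move=> ST [[a [s [Ss ->]]] _ _ p_irr]; exists a, s; split=> //; last exact: ST.
have Ts := ST s Ss; have s0 := acts_neq0 Ts.
have sF : s%:F != 0 by rewrite tofrac_eq0.
have unit_acts (b c : R) : unit_in (localisation S) ((b * c)%:F / s%:F) -> T b.
  move=> [_ [_ [[b' [s' [Ss' ->]]] bs']]]; have Ts' := ST s' Ss'.
  apply: (@acts_divl _ _ _ (c * b')).
  suff -> : b * (c * b') = s * s' by exact: actsM.
  apply/eqP; rewrite -tofrac_eq; apply/eqP/divr1_eq.
  by rewrite mulrA !tofracM -mulf_div -tofracM.
apply: locally_maximal_acts_bijectively => x.
have [d [a' [x' [aE xE [u [v duv]]]]]] := bezout2 R_bezout a x.
have locM b : localisation S (b%:F / s%:F) by exists b, s.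
have [|||Td|Ta'] := p_irr ((d * s)%:F / s%:F) ((a' * 1)%:F / s%:F).
- exact: locM.
- exact: locM.
- by rewrite aE mulr1 !tofracM mulfK // mulrA [d%:F * _]mulrC.
- by right; exists v, u; rewrite addrC -duv; exact: unit_acts Td.
- left; exists a', x'; split; first exact: unit_acts Ta'.
  by rewrite aE xE; ring.
Qed.

Lemma S_next_acts_bijectively (S : set R) :
  (S `<=` T)%classic -> (S_next S `<=` T)%classic.
Proof.
move=> ST r Sr.
suff frac z : S_of (localisation S) z ->
    exists a t, [/\ T a, T t & z = a%:F / t%:F].
  have [a [t [Ta Tt /eqP rat]]] := frac _ Sr; apply: (@acts_divl _ _ _ t).
  suff -> : r * t = a by [].
  apply/eqP; rewrite -tofrac_eq tofracM.
  by rewrite (eqP rat) divfK // tofrac_eq0; exact: acts_neq0.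
elim=> {z} [z [[a [s [Ss ->]]] [_ [[b [s' [Ss' ->]]] ab]]]|z|x y _ IHx _ IHy].
- have Ts := ST s Ss; exists a, s; split=> //; apply: (@acts_divl _ _ _ b).
  suff -> : a * b = s * s' by apply: actsM => //; exact: ST.
  apply/eqP; rewrite -tofrac_eq; apply/eqP/divr1_eq.
  by rewrite !tofracM -mulf_div.
- exact: irreducible_acts_bijectively.
- have [[a [s [Ta Ts ->]]] [b [t [Tb Tt ->]]]] := (IHx, IHy).
  exists (a * b), (s * t); split; [exact: actsM | exact: actsM |].
  by rewrite !tofracM mulf_div.
Qed.

Lemma S_stage_acts_bijectively (d : Order.disp_t) (W : orderType d)
    (wfW : well_founded (fun v w : W => (v < w)%O)) (w : W) :
  (@S_stage d W wfW R w `<=` T)%classic.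
Proof.
elim/(well_founded_ind wfW): w => w IH r; rewrite S_stageE.
case=> [[_ r_unit]|[v [vw [_]]]|[_ [v [vw]]]].
- by exists (fun x => r^-1 *: x) => x; rewrite scalerA ?mulVr ?divrr ?scale1r.
- by apply: S_next_acts_bijectively; exact: IH.
- exact: IH.
Qed.

End Superdecomposable.

Theorem theorem6p11 (R : idomainType) (hR : bezout_domain R)
  (M : lmodType R) (hsd : superdecomposable M) (hpi : pure_injective M) :
  localised_module (@S_infty R) M.
Proof.
move=> s [d [W [wfW [w Ss]]]].
exact: (S_stage_acts_bijectively hR hsd hpi Ss).
Qed.
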